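(* Let $\mathbf A=(A;w)$ be a finite algebra whose only basic operation $w$ is an $n$-ary weak near-unanimity operation, and let ${\sim}$ be an Abelian congruence of $\mathbf A$ with ${\sim}\prec 1_{\mathbf A}$ in $\mathrm{Con}\,\mathbf A$ and $\mathrm{typ}({\sim},1_{\mathbf A})=\mathbf 5$. Let $\le$ be the order on $A/{\sim}$ described below and $w_{|A|}$ the term operation defined below. If $O,I\in A/{\sim}$ and $O<I$, then $O\cup I$ is a subuniverse of $(A;w_{|A|})$, and for all $x_1,\dots,x_n\in\{O,I\}$ we have $w_{|A|}^{\mathbf A/{\sim}}(x_1,\dots,x_n)=x_1\wedge\dots\wedge x_n$, where $\wedge$ is the meet on $\{O,I\}$ with respect to $O<I$.
   Context: An $n$-ary operation $w$ is a weak near-unanimity (wnu) operation if it is idempotent and satisfies $w(x,\dots,x,y)=w(x,\dots,x,y,x)=\dots=w(y,x,\dots,x)$. Types are those of tame congruence theory. Order on $A/{\sim}$: for every $({\sim},1_{\mathbf A})$-minimal set $U$ (whose body is all of $U$), $U$ meets exactly two ${\sim}$-classes $C_1,C_2$, and the polynomial operations of $\mathbf A$ restricted to $U$ induce a two-element semilattice on $\{C_1\cap U, C_2\cap U\}$ modulo ${\sim}$; declare $C_1$ below $C_2$ if $C_1\cap U$ is the bottom of this semilattice. $\le$ is the reflexive-transitive closure of these relations over all minimal sets; it is a connected partial order on $A/{\sim}$, and $<$ is its strict part. Define operations $w_i$: $w_1=w$; $x\circ_i y:=w_i(y,x,\dots,x)$; $w_{i+1}(x_1,\dots,x_n)=w_i(w_i(x_1,\dots,x_n)\circ_i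 x_1,\dots,w_i(x_1,\dots,x_n)\circ_i x_n)$. *)

(* Defs.v *)
From mathcomp Require Import all_boot.
From Stdlib Require Export Relation_Operators.

Set Implicit Arguments.
Unset Strict Implicit.
Unset Printing Implicit Defensive.

(* An algebra with a single n-ary basic operation is given by its carrier and *)
(* that operation; relations on a finite carrier are boolean, and the         *)
(* elements of a quotient are the equivalence classes, as finite sets.        *)

Definition operation (A : Type) (n : nat) := n.-tuple A -> A.

Section Polynomials.
Variables (A : Type) (n : nat) (w : operation A n).

Inductive pterm (m : nat) : Type :=
| PVar of 'I_m
| PConst of A
| POp of 'I_n -> pterm m.

Fixpoint peval m (t : pterm m) (x : m.-tuple A) : A :=
  match t with
  | PVar i => tnth x i
  | PConst a => a
  | POp args => w [tuple peval (args i) x | i < n]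
  end.

Definition polynomial m (f : operation A m) : Prop :=
  exists t : pterm m, f =1 peval t.

End Polynomials.

Section WNU.
Variables (A : eqType) (n : nat).

Definition one_at (i : nat) (x y : A) : n.-tuple A :=
  [tuple if k == i :> nat then y else x | k < n].

Definition idempotent_op (w : operation A n) : Prop :=
  forall x, w [tuple x | _ < n] = x.

Definition weak_near_unanimity (w : operation A n) : Prop :=
  idempotent_op w /\
  forall (i j : 'I_n) (x y : A), w (one_at i x y) = w (one_at j x y).

Definition circ (f : operation A n) (x y : A) : A := f (one_at 0 x y).

Definition wnu_step (f : operation A n) : operation A n :=
  fun x => f [tuple circ f (f x) (tnth x k) | k < n].

(* The sequence is indexed from 1: wnu_seq w 1 = w. *)
Definition wnu_seq (w : operation A n) (i : nat) : operation A n :=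
  iter i.-1 wnu_step w.

End WNU.

Section Congruences.
Variables (A : finType) (n : nat) (w : operation A n).
Implicit Types (alpha beta theta e : rel A) (U N C S : {set A}).

Definition full_rel : rel A := fun _ _ => true.

Definition congruence e : Prop :=
  equivalence_rel e /\
  forall x y : n.-tuple A,
    (forall i, e (tnth x i) (tnth y i)) -> e (w x) (w y).

Definition covered_by alpha beta : Prop :=
  [/\ congruence alpha, congruence beta, subrel alpha beta,
      ~ subrel beta alpha &
      forall theta, congruence theta ->
        subrel alpha theta -> subrel theta beta ->
        theta =2 alpha \/ theta =2 beta].

(* The term condition C(alpha, beta; theta) defining the commutator. *)
Definition centralizes alpha beta theta : Prop :=
  forall m (f : operation A m.+1), polynomial w f ->
  forall (a b : A) (u v : m.-tuple A),
    alpha a b -> (forall i, beta (tnth u i) (tnth v i)) ->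
    theta (f [tuple of a :: u]) (f [tuple of a :: v]) <->
    theta (f [tuple of b :: u]) (f [tuple of b :: v]).

Definition abelian_congruence alpha : Prop :=
  congruence alpha /\ centralizes alpha alpha eq_op.

Definition classes e : {set {set A}} := equivalence_partition e [set: A].

Definition quotient_op m e (f : operation A m) (X : m.-tuple {set A}) :
    {set A} :=
  [set y | [exists x : m.-tuple A,
             [forall i, tnth x i \in tnth X i] && e (f x) y]].

Definition subuniverse m (f : operation A m) S : Prop :=
  forall x : m.-tuple A, (forall i, tnth x i \in S) -> f x \in S.

(* Images f(A) of the unary polynomials f with f(beta) not inside alpha. *)
Definition separating_image alpha beta U : Prop :=
  exists f : operation A 1,
    [/\ polynomial w f,
        exists x y, beta x y /\ ~~ alpha (f [tuple x]) (f [tuple y]) &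
        U = [set f [tuple x] | x in [set: A]]].

Definition minimal_set alpha beta U : Prop :=
  separating_image alpha beta U /\
  forall V : {set A}, separating_image alpha beta V -> V \subset U -> V = U.

Definition trace_of alpha beta U N : Prop :=
  exists x, [/\ x \in U, N = [set y in U | beta x y] &
                ~~ (N \subset [set y | alpha x y])].

Definition bool_meet : operation bool 2 :=
  fun x => tnth x ord0 && tnth x ord_max.

(* phi induces an isomorphism of the quotient by alpha of the algebra induced *)
(* by A on N (whose operations are the restrictions to N of the polynomials   *)
(* of A that preserve N) onto an algebra on bool polynomially equivalent to   *)
(* the semilattice (bool; &&), in which false is the bottom element.          *)
Definition semilattice_chart alpha N (phi : A -> bool) : Prop :=
  [/\ {in N &, forall x y, alpha x y = (phi x == phi y)},
      phi @: N = [set: bool] &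
      forall m (g : operation bool m),
        polynomial bool_meet g <->
        exists f : operation A m,
          [/\ polynomial w f, subuniverse f N &
              forall x : m.-tuple A, (forall i, tnth x i \in N) ->
                phi (f x) = g (map_tuple phi x)]].

(* When alpha is covered by beta, minimal sets and traces exist and all traces *)
(* have the same type, so quantifying over all of them is not vacuous.         *)
Definition has_type5 alpha beta : Prop :=
  forall U N, minimal_set alpha beta U -> trace_of alpha beta U N ->
  exists phi, semilattice_chart alpha N phi.

(* For beta = full_rel the only trace of a minimal set U is U itself. *)
Definition basic_below e (C1 C2 : {set A}) : Prop :=
  [/\ C1 \in classes e, C2 \in classes e &
      exists U phi,
        [/\ minimal_set e full_rel U, semilattice_chart e U phi,
            C1 :&: U = [set x in U | ~~ phi x] &
            C2 :&: U = [set x in U | phi x]]].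

Definition class_le e : {set A} -> {set A} -> Prop :=
  clos_refl_trans {set A} (basic_below e).

Definition class_lt e (C1 C2 : {set A}) : Prop :=
  class_le e C1 C2 /\ C1 <> C2.

(* The binary meet on the two-element chain O < I. *)
Definition chain_meet (O I X Y : {set A}) : {set A} :=
  if (X == O) || (Y == O) then O else I.

End Congruences.

Arguments full_rel {A}.

(* Main.v *)
(* Working modulo sim, every polynomial is monotone for the order generated   *)
(* by the oriented minimal sets, and e below denotes a polynomial retraction  *)
(* onto a minimal set, seen as a map onto the two-element chain. As that      *)
(* minimal set has no join polynomial, e (h b a') = e (h a b') = 1 with       *)
(* a <= b and a' <= b' forces e (h a a') = 1, for every binary polynomial h.  *)
(* It follows for any wnu polynomial f that f(D, C, ..., C) = C if C <= D and *)
(* f(C, D, ..., D) < D if C < D. Hence the values w_i(O, I, ..., I) strictly  *)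
(* decrease until they reach O, which takes at most |A| steps; monotonicity   *)
(* then gives the values at all other tuples over {O, I}.                     *)

Require Import Defs.
From mathcomp Require Import all_boot.
From Stdlib Require Import Classical_Prop Operators_Properties.

Set Implicit Arguments.
Unset Strict Implicit.
Unset Printing Implicit Defensive.

(** The argument works with elements modulo [sim]. From type 5, an [elem_step] retains a minimal set
    meeting just two classes, a meet polynomial on them and the absence of a join polynomial
    ([basic_below_elem_step]). Because [sim] is maximal, a polynomial that separates two points of a
    minimal set modulo [sim] has a polynomial left inverse on it ([minimal_set_left_inverse]). Hence
    polynomials either collapse a step or carry it to a step ([elem_step_unary]), and the generated
    preorder [elem_le] is preserved by all polynomials ([elem_le_polynomial]).

    Retractions onto a step make [elem_le] antisymmetric modulo [sim], and [retraction_meet] spreads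
    the absence of joins from steps to all comparable pairs. For a wnu polynomial f and a strictly
    below b, this puts f(b, a, ..., a) in the class of a ([wnu_low]) and f(a, b, ..., b) strictly
    below b ([wnu_high]). Therefore the values w_i(a, b, ..., b) descend strictly until they reach
    the class of a, within |A| steps ([wnu_seq_low]). A tuple over O and I with a coordinate in O
    lies between a constant tuple in O and a tuple with a single entry in O, and monotonicity
    decides its value. *)

(** On [U] the map is a permutation whose cycle lengths all divide the factorial of #|T|, so one
    power of it is its inverse. Being an iterate, that inverse is a polynomial whenever [s] is. *)
Lemma iter_period (T : finType) (s : T -> T) (U : {set T}) :
  {homo s : x / x \in U} -> {in U &, injective s} ->
  exists k, {in U, forall x, iter k s (s x) = x}.
Proof.
move=> sU s_inj; exists (#|T|`!).-1 => x xU.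
rewrite -iterSr prednK ?fact_gt0 //.
have /dvdnP[q ->] : order s x %| #|T|`!.
  by rewrite dvdn_fact // order_gt0 max_card.
elim: q => [|q IHq]; first by rewrite mul0n.
by rewrite mulSn iterD IHq (iter_order_in sU).
Qed.

(** * Calculus of polynomial operations *)

Section Polynomials.
Variables (A : Type) (n : nat) (w : operation A n).

Fixpoint psubst m k (t : pterm A n m) (s : 'I_m -> pterm A n k) :=
  match t with
  | PVar i => s i
  | PConst a => PConst n k a
  | POp args => POp (fun i => psubst (args i) s)
  end.

Lemma peval_subst m k (t : pterm A n m) (s : 'I_m -> pterm A n k) x :
  peval w (psubst t s) x = peval w t [tuple peval w (s i) x | i < m].
Proof.
elim: t => [i|a|args IH] //=; first by rewrite tnth_mktuple.
by congr (w _); apply: eq_from_tnth => i; rewrite !tnth_mktuple IH.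
Qed.

Lemma polynomial_ext m (f g : operation A m) :
  f =1 g -> polynomial w f -> polynomial w g.
Proof. by move=> fg [t ft]; exists t => x; rewrite -fg. Qed.

Lemma polynomial_var m (i : 'I_m) : polynomial w (fun x => tnth x i).
Proof. by exists (PVar A n i). Qed.

Lemma polynomial_const m a : polynomial w (fun _ : m.-tuple A => a).
Proof. by exists (PConst n m a). Qed.

Lemma polynomial_basic : polynomial w w.
Proof.
exists (POp (fun i => PVar A n i)) => x /=.
by congr (w _); apply: eq_from_tnth => i; rewrite tnth_mktuple.
Qed.

Lemma polynomial_comp m k (f : operation A m) (g : 'I_m -> operation A k) :
  polynomial w f -> (forall i, polynomial w (g i)) ->
  polynomial w (fun x => f [tuple g i x | i < m]).
Proof.
case=> t ft /fin_all_exists [s gs]; exists (psubst t s) => x.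
rewrite ft peval_subst; congr (peval w t _).
by apply: eq_from_tnth => i; rewrite !tnth_mktuple gs.
Qed.

(** Curried forms, so that polynomials compose as ordinary functions. *)
Definition unary_polynomial (p : A -> A) : Prop :=
  polynomial w (fun x : 1.-tuple A => p (tnth x ord0)).

Definition binary_polynomial (h : A -> A -> A) : Prop :=
  polynomial w (fun x : 2.-tuple A => h (tnth x ord0) (tnth x ord_max)).

Lemma polynomial_comp1 p k (f : operation A k) :
  unary_polynomial p -> polynomial w f -> polynomial w (fun x => p (f x)).
Proof.
move=> pp pf.
apply: polynomial_ext (polynomial_comp (g := fun _ => f) pp (fun _ => pf)) => x.
by rewrite tnth_mktuple.
Qed.

Lemma polynomial_comp2 h k (f g : operation A k) :
  binary_polynomial h -> polynomial w f -> polynomial w g ->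
  polynomial w (fun x => h (f x) (g x)).
Proof.
move=> ph pf pg.
have pfg (i : 'I_2) : polynomial w (if i == ord0 then f else g) by case: ifP.
apply: polynomial_ext (polynomial_comp ph pfg) => x.
by rewrite !tnth_mktuple.
Qed.

Lemma unary_polynomial_of (f : operation A 1) :
  polynomial w f -> unary_polynomial (fun x => f [tuple x]).
Proof.
move=> pf; apply: polynomial_ext pf => x; congr f.
by apply: eq_from_tnth => i; rewrite !ord1.
Qed.

Lemma binary_polynomial_of (f : operation A 2) :
  polynomial w f -> binary_polynomial (fun x y => f [tuple x; y]).
Proof.
move=> pf; apply: polynomial_ext pf => x; congr f.
apply: eq_from_tnth => -[[|[|//]] lt_i] /=; rewrite [RHS](tnth_nth (tnth x ord0)) /=;
  by congr tnth; apply: val_inj.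
Qed.

Lemma unary_polynomial_id : unary_polynomial id.
Proof. exact: polynomial_var. Qed.

Lemma unary_polynomial_iter p k :
  unary_polynomial p -> unary_polynomial (iter k p).
Proof.
move=> pp; elim: k => [|k IHk]; first exact: polynomial_var.
exact: polynomial_comp1 pp IHk.
Qed.

Lemma binary_polynomial_l h b :
  binary_polynomial h -> unary_polynomial (h^~ b).
Proof.
by move=> ph; apply: polynomial_comp2 => //;
  [apply: polynomial_var | apply: polynomial_const].
Qed.

Lemma binary_polynomial_r h a : binary_polynomial h -> unary_polynomial (h a).
Proof.
by move=> ph; apply: polynomial_comp2 => //;
  [apply: polynomial_const | apply: polynomial_var].
Qed.

Lemma binary_polynomial_comp p q r h :
  unary_polynomial p -> unary_polynomial q -> unary_polynomial r ->
  binary_polynomial h -> binary_polynomial (fun x y => p (h (q x) (r y))).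
Proof.
move=> pp pq pr ph; apply: polynomial_comp1 => //.
by apply: polynomial_comp2 => //; apply: polynomial_comp1 => //;
  apply: polynomial_var.
Qed.

(* The arguments are changed one coordinate at a time. *)
Lemma polynomial_compat (R : A -> A -> Prop) m (f : operation A m) x y :
  (forall a, R a a) -> (forall a b c, R a b -> R b c -> R a c) ->
  (forall p, unary_polynomial p -> forall a b, R a b -> R (p a) (p b)) ->
  polynomial w f -> (forall i, R (tnth x i) (tnth y i)) -> R (f x) (f y).
Proof.
move=> Rxx Rtr Rp pf Rxy.
pose z k := [tuple if i < k then tnth y i else tnth x i | i < m].
suff Rz k : k <= m -> R (f x) (f (z k)).
  suff <- : z m = y by apply: Rz.
  by apply: eq_from_tnth => i; rewrite tnth_mktuple ltn_ord.
elim: k => [_|k IHk lt_km].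
  suff -> : z 0 = x by [].
  by apply: eq_from_tnth => i; rewrite tnth_mktuple.
apply: Rtr (IHk (ltnW lt_km)) _.
pose K := Ordinal lt_km.
pose p a := f [tuple if i < k then tnth y i else if i == K then a else tnth x i
                    | i < m].
have pp : unary_polynomial p.
  apply: (polynomial_comp (g := fun i (a : 1.-tuple A) => if i < k then tnth y i
            else if i == K then tnth a ord0 else tnth x i)) => // i.
  case: (i < k); first exact: polynomial_const.
  by case: (i == K); [apply: polynomial_var | apply: polynomial_const].
have -> : f (z k) = p (tnth x K).
  congr f; apply: eq_from_tnth => i; rewrite !tnth_mktuple.
  by case: ifP => // _; case: eqP => // ->.
have -> : f (z k.+1) = p (tnth y K).
  congr f; apply: eq_from_tnth => i; rewrite !tnth_mktuple ltnS leq_eqVlt.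
  rewrite -[_ == k]/(i == K).
  by case: eqP => [->|_] /=; [rewrite ltnn | case: ifP].
exact: Rp.
Qed.

End Polynomials.

(** Variables, constants and meets all commute with the meet. This is what rules out a join among
    the polynomials of the two-element semilattice. *)
Lemma bool_polynomial_meet m (g : operation bool m) (x y : m.-tuple bool) :
  polynomial bool_meet g ->
  g [tuple tnth x i && tnth y i | i < m] = g x && g y.
Proof.
case=> t gt; rewrite !gt.
elim: t {g gt} => [i|a|args IH] /=; first by rewrite tnth_mktuple.
  by rewrite andbb.
by rewrite /bool_meet !tnth_mktuple !IH andbACA.
Qed.

(** * The recursion step on wnu operations *)

Lemma polynomial_wnu_step (A : eqType) n (w f : operation A n) :
  polynomial w f -> polynomial w (wnu_step f).
Proof.
move=> pf; apply: (polynomial_comp (g := fun k x => circ f (f x) (tnth x k))) => // k.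
apply: polynomial_ext (polynomial_comp
  (g := fun i x => if i == 0 :> nat then tnth x k else f x) pf _) => // i.
by case: (i == 0 :> nat) => //; apply: polynomial_var.
Qed.

Lemma wnu_step_one_at (A : eqType) n (f : operation A n) i x y :
  wnu_step f (one_at n i x y) =
  f (one_at n i (circ f (f (one_at n i x y)) x) (circ f (f (one_at n i x y)) y)).
Proof.
by congr f; apply: eq_from_tnth => k; rewrite !tnth_mktuple; case: ifP.
Qed.

Lemma wnu_step_wnu (A : eqType) n (f : operation A n) :
  weak_near_unanimity f -> weak_near_unanimity (wnu_step f).
Proof.
case=> f_id f_sym.
split=> [x|i j x y]; last by rewrite !wnu_step_one_at (f_sym i j) (f_sym i j).
rewrite /wnu_step f_id -[RHS]f_id; congr f; apply: eq_from_tnth => k.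
rewrite !tnth_mktuple -[RHS]f_id /circ; congr f.
by apply: eq_from_tnth => i; rewrite !tnth_mktuple if_same.
Qed.

(** * Minimal sets of the covering pair and their polynomial images *)

Section MinimalSets.
Variables (A : finType) (n : nat) (w : operation A n) (sim : rel A).
Hypothesis sim_cover : covered_by w sim full_rel.
Implicit Types (U : {set A}) (p q : A -> A) (h : A -> A -> A).

Let sim_cong : congruence w sim. Proof. by case: sim_cover. Qed.

Lemma sim_refl x : sim x x.
Proof. by case: sim_cong => eqv _; case: (eqv x x x). Qed.

Lemma sim_sym x y : sim x y = sim y x.
Proof.
case: sim_cong => eqv _; apply/idP/idP => xy.
  by case: (eqv x y x) => _ <- //; apply: sim_refl.
by case: (eqv y x y) => _ <- //; apply: sim_refl.
Qed.

Lemma sim_trans y x z : sim x y -> sim y z -> sim x z.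
Proof. by case: sim_cong => eqv _ xy; case: (eqv x y z) => _ ->. Qed.

Lemma sim_polynomial m (f : operation A m) x y :
  polynomial w f -> (forall i, sim (tnth x i) (tnth y i)) -> sim (f x) (f y).
Proof.
case=> t ft xy; rewrite !ft.
elim: t {f ft} => [i|a|args IH] //=; first exact: sim_refl.
by case: sim_cong => _; apply=> i; rewrite !tnth_mktuple.
Qed.

Lemma sim_unary p a b : unary_polynomial w p -> sim a b -> sim (p a) (p b).
Proof.
move=> pp ab; apply: (sim_polynomial (x := [tuple a]) (y := [tuple b]) pp) => i.
by rewrite !ord1.
Qed.

Lemma sim_binary h a b c d :
  binary_polynomial w h -> sim a b -> sim c d -> sim (h a c) (h b d).
Proof.
move=> ph ab cd; apply: (sim_polynomial (x := [tuple a; c]) (y := [tuple b; d]) ph).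
by case=> [[|[|//]] lt_i].
Qed.

(* The pairs that no f \o g separates form a congruence containing sim and    *)
(* different from the full relation, hence equal to sim by maximality.        *)
Lemma separating_translation (f : A -> A) a b :
  unary_polynomial w f -> (exists x y, ~~ sim (f x) (f y)) -> ~~ sim a b ->
  exists2 g, unary_polynomial w g & ~~ sim (f (g a)) (f (g b)).
Proof.
move=> pf [x [y nfxy]] nab; apply: NNPP => no_g.
pose P (z : A * A) :=
  forall g, unary_polynomial w g -> sim (f (g z.1)) (f (g z.2)).
(* Congruences are boolean relations, whereas [P] quantifies over all polynomials; excluded middle
   at each of the finitely many pairs makes it boolean. *)
have [th thP] : exists th : A * A -> bool, forall z, th z <-> P z.
  apply: (fin_all_exists (P := fun z (t : bool) => t <-> P z)) => z.
  by case: (classic (P z)) => Pz; [exists true | exists false].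
pose theta : rel A := fun u v => th (u, v).
have thetaP u v : theta u v <-> P (u, v) by apply: thP.
have th_refl u : theta u u by apply/thetaP => g _; apply: sim_refl.
have th_sym u v : theta u v -> theta v u.
  by move=> /thetaP uv; apply/thetaP => g pg; rewrite sim_sym; apply: uv.
have th_trans u v z : theta u v -> theta v z -> theta u z.
  move=> /thetaP uv /thetaP vz; apply/thetaP => g pg.
  exact: sim_trans (uv g pg) (vz g pg).
have th_cong : congruence w theta.
  split=> [u v z|u v uv].
    split=> // uv; apply/idP/idP; last exact: th_trans.
    by apply: th_trans; apply: th_sym.
  apply: (@polynomial_compat _ _ w theta) (polynomial_basic w) uv => //.
  move=> p pp c d /thetaP cd; apply/thetaP => g pg.
  exact: (cd (g \o p)) (polynomial_comp1 pg pp).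
case: sim_cover => _ _ _ _ /(_ theta th_cong) [] //.
- move=> u v uv; apply/thetaP => g pg.
  exact: sim_unary pf (sim_unary pg uv).
- move=> /(_ a b) th_ab; case/negP: nab; rewrite -th_ab; apply/thetaP => g pg /=.
  by apply: contraT => ngab; case: no_g; exists g.
- move=> th_full; case/negP: nfxy.
  have /thetaP th_xy : theta x y by rewrite th_full.
  exact: th_xy (unary_polynomial_id w).
Qed.

Lemma minimal_setP U : minimal_set w sim full_rel U ->
  exists2 f, unary_polynomial w f &
    (exists x y, ~~ sim (f x) (f y)) /\ U = [set f x | x in [set: A]].
Proof.
case=> -[f [pf [x [y [_ nfxy]]] U_def]] _.
exists (fun x => f [tuple x]); first exact: unary_polynomial_of.
by split=> //; exists x, y.
Qed.

Lemma separating_image_unary p x y :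
  unary_polynomial w p -> ~~ sim (p x) (p y) ->
  separating_image w sim full_rel [set p x | x in [set: A]].
Proof.
move=> pp nxy; exists (fun x => p (tnth x ord0)); split=> //.
by exists x, y.
Qed.

(** Write U = f(A). Some translation g keeps f(g(p u)) and f(g(p v)) apart, so s = f g p maps U onto
    a separating image inside U, which is U by minimality. Thus s permutes U, and if s^k inverts it
    there, s^k f g is the left inverse of p. *)
Lemma minimal_set_left_inverse U p u v :
  minimal_set w sim full_rel U -> unary_polynomial w p ->
  u \in U -> v \in U -> ~~ sim (p u) (p v) ->
  exists2 q, unary_polynomial w q &
    (forall x, q x \in U) /\ {in U, forall x, q (p x) = x}.
Proof.
move=> minU pp uU vU npuv; have [f pf [fsep U_def]] := minimal_setP minU.
have [g pg ngf] := separating_translation pf fsep npuv.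
pose s x := f (g (p x)).
have fU x : f x \in U by rewrite U_def imset_f.
have ps : unary_polynomial w s := polynomial_comp1 pf (polynomial_comp1 pg pp).
have sUU : s @: U = U.
  case: minU => _; apply; last by apply/subsetP => _ /imsetP[x _ ->]; apply: fU.
  move: uU vU; rewrite {1 2}U_def => /imsetP[u' _ uE] /imsetP[v' _ vE].
  have -> : s @: U = [set s (f x) | x in [set: A]].
    by rewrite U_def -imset_comp.
  apply: (@separating_image_unary (s \o f) u' v').
    exact: polynomial_comp1 ps pf.
  by rewrite /= -uE -vE.
have s_inj : {in U &, injective s} by apply/imset_injP; rewrite sUU.
have [k sK] := iter_period (fun x _ => fU _ : s x \in U) s_inj.
exists (fun x => iter k s (f (g x))).
  exact: polynomial_comp1 (unary_polynomial_iter k ps) (polynomial_comp1 pf pg).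
by split=> x; [case: k {sK} => [|k] /=; apply: fU | apply: sK].
Qed.

(** A left inverse q of p on U sends a separating image V inside p(U) to a separating image inside
    U, hence onto U. Therefore V has at least as many elements as U, and so as p(U). *)
Lemma minimal_set_image U p u v :
  minimal_set w sim full_rel U -> unary_polynomial w p ->
  u \in U -> v \in U -> ~~ sim (p u) (p v) ->
  minimal_set w sim full_rel (p @: U).
Proof.
move=> minU pp uU vU npuv.
have [q pq [qU qK]] := minimal_set_left_inverse minU pp uU vU npuv.
have [f pf [_ U_def]] := minimal_setP minU.
split.
  have -> : p @: U = [set p (f x) | x in [set: A]].
    by rewrite U_def -imset_comp.
  move: uU vU; rewrite U_def => /imsetP[u' _ uE] /imsetP[v' _ vE].
  by apply: (@separating_image_unary (p \o f) u' v');
    [apply: (polynomial_comp1 pp pf) | rewrite /= -uE -vE].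
move=> V [g [pg [x [y [_ ngxy]]] V_def]] sVpU.
apply/eqP; rewrite eqEcard sVpU /=.
apply: leq_trans (leq_imset_card _ _) _.
suff <- : q @: V = U by apply: leq_imset_card.
case: minU => _; apply; last by apply/subsetP => _ /imsetP[z _ ->]; apply: qU.
have -> : q @: V = [set q (g [tuple z]) | z in [set: A]].
  by rewrite V_def -imset_comp.
apply: (@separating_image_unary (fun z => q (g [tuple z])) x y).
  exact: polynomial_comp1 pq (unary_polynomial_of pg).
have gpU z : g [tuple z] \in p @: U.
  by apply: (subsetP sVpU); rewrite V_def imset_f.
have /imsetP[x' x'U xE] := gpU x; have /imsetP[y' y'U yE] := gpU y.
move: ngxy; rewrite xE yE !qK //; apply: contra; exact: sim_unary.
Qed.

(** * Steps between elements and the preorder they generate *)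

(* The elementwise form of basic_below: only the absence of a join polynomial *)
(* and the presence of a meet polynomial are kept from the semilattice chart. *)
Definition elem_step (a b : A) : Prop :=
  [/\ ~~ sim a b,
      exists U u v, [/\ minimal_set w sim full_rel U, u \in U, v \in U,
                        sim a u /\ sim b v &
                        {in U, forall x, sim x a || sim x b}],
      exists2 m, binary_polynomial w m &
        [/\ sim (m a b) a, sim (m b a) a & sim (m b b) b] &
      forall h, binary_polynomial w h ->
        sim (h a b) b -> sim (h b a) b -> ~~ sim (h a a) a].

Lemma elem_step_sim a b a' b' :
  sim a a' -> sim b b' -> elem_step a b -> elem_step a' b'.
Proof.
move=> aa' bb' [nab [U [u [v [minU uU vU [au bv] Uab]]]] [m pm [m1 m2 m3]] nojoin].
have a'a : sim a' a by rewrite sim_sym.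
have b'b : sim b' b by rewrite sim_sym.
split.
- apply: contra nab => a'b'; exact: sim_trans aa' (sim_trans a'b' b'b).
- exists U, u, v; split=> //; first by split; apply: sim_trans; eassumption.
  move=> x /Uab /orP[xa|xb]; apply/orP; [left|right];
    apply: sim_trans; eassumption.
- exists m => //; split.
  + exact: sim_trans (sim_trans (sim_binary pm a'a b'b) m1) aa'.
  + exact: sim_trans (sim_trans (sim_binary pm b'b a'a) m2) aa'.
  + exact: sim_trans (sim_trans (sim_binary pm b'b b'b) m3) bb'.
move=> h ph h1 h2; apply: contra (nojoin h ph _ _) => [h3||].
- exact: sim_trans (sim_trans (sim_binary ph aa' aa') h3) a'a.
- exact: sim_trans (sim_trans (sim_binary ph aa' bb') h1) b'b.
- exact: sim_trans (sim_trans (sim_binary ph bb' aa') h2) b'b.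
Qed.

Lemma elem_step_asym a b : elem_step a b -> ~ elem_step b a.
Proof.
case=> _ _ _ nojoin [_ _ [m pm [m1 m2 m3]] _].
by case/negP: (nojoin m pm m2 m1).
Qed.

Lemma elem_step_left_inverse a b p :
  elem_step a b -> unary_polynomial w p -> ~~ sim (p a) (p b) ->
  exists2 q, unary_polynomial w q &
    [/\ forall x, sim (q x) a || sim (q x) b, sim (q (p a)) a & sim (q (p b)) b].
Proof.
move=> [_ [U [u [v [minU uU vU [au bv] Uab]]]] _ _] pp npab.
have npuv : ~~ sim (p u) (p v).
  apply: contra npab => puv; apply: sim_trans (sim_unary pp au) _.
  by apply: sim_trans puv _; apply: sim_unary => //; rewrite sim_sym.
have [q pq [qU qK]] := minimal_set_left_inverse minU pp uU vU npuv.
have qp_sim c z : sim c z -> z \in U -> sim (q (p c)) c.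
  move=> cz zU; apply: (@sim_trans z); last by rewrite sim_sym.
  by rewrite -[z in sim _ z](qK z zU); apply: sim_unary pq (sim_unary pp cz).
by exists q => //; split=> [x||]; [apply: Uab | apply: qp_sim uU | apply: qp_sim vU].
Qed.

(** Everything is transported along p and its left inverse q: a meet m becomes p(m(q x, q y)), and a
    join h on the image would pull back to the join q(h(p x, p y)) on the original step. *)
Lemma elem_step_unary a b p :
  elem_step a b -> unary_polynomial w p -> ~~ sim (p a) (p b) ->
  elem_step (p a) (p b).
Proof.
move=> st pp npab; have [q pq [_ qa qb]] := elem_step_left_inverse st pp npab.
case: st => _ [U [u [v [minU uU vU [au bv] Uab]]]] [m pm [m1 m2 m3]] nojoin.
have pau := sim_unary pp au; have pbv := sim_unary pp bv.
split=> //.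
- exists (p @: U), (p u), (p v); split; rewrite ?imset_f //.
    apply: (minimal_set_image minU pp uU vU); apply: contra npab => puv.
    by apply: sim_trans pau (sim_trans puv _); rewrite sim_sym.
  by move=> _ /imsetP[x xU ->]; case/orP: (Uab x xU) => xc; apply/orP;
    [left|right]; apply: sim_unary.
- exists (fun x y => p (m (q x) (q y))); first exact: (binary_polynomial_comp pp pq pq pm).
  split; apply: sim_unary => //.
  + exact: sim_trans (sim_binary pm qa qb) m1.
  + exact: sim_trans (sim_binary pm qb qa) m2.
  + exact: sim_trans (sim_binary pm qb qb) m3.
move=> h ph h1 h2.
have := nojoin _ (binary_polynomial_comp pq pp pp ph)
  (sim_trans (sim_unary pq h1) qb) (sim_trans (sim_unary pq h2) qb).
by apply: contra => h3; apply: sim_trans (sim_unary pq h3) qa.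
Qed.

Definition elem_le : A -> A -> Prop :=
  clos_refl_trans A (fun a b => sim a b \/ elem_step a b).

Lemma elem_le_sim a b : sim a b -> elem_le a b.
Proof. by move=> ab; apply: rt_step; left. Qed.

Lemma elem_le_step a b : elem_step a b -> elem_le a b.
Proof. by move=> ab; apply: rt_step; right. Qed.

Lemma elem_le_refl a : elem_le a a.
Proof. exact: rt_refl. Qed.

Lemma elem_le_trans b a c : elem_le a b -> elem_le b c -> elem_le a c.
Proof. exact: rt_trans. Qed.

Lemma elem_le_unary p a b :
  unary_polynomial w p -> elem_le a b -> elem_le (p a) (p b).
Proof.
move=> pp; elim=> {a b} [a b [ab|ab]|a|a b c _ ab _ bc].
- exact/elem_le_sim/sim_unary.
- have [pab|npab] := boolP (sim (p a) (p b)); first exact: elem_le_sim.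
  exact/elem_le_step/elem_step_unary.
- exact: elem_le_refl.
- exact: elem_le_trans ab bc.
Qed.

Lemma elem_le_polynomial m (f : operation A m) x y :
  polynomial w f -> (forall i, elem_le (tnth x i) (tnth y i)) ->
  elem_le (f x) (f y).
Proof.
apply: polynomial_compat; [exact: elem_le_refl|exact: rt_trans|].
by move=> p pp a b; apply: elem_le_unary.
Qed.

Lemma elem_le_first_step a b :
  elem_le a b -> sim a b \/ exists2 c, elem_step a c & elem_le c b.
Proof.
move=> ab; elim: (clos_rt_rt1n _ _ _ _ ab) => {a b ab} [a|a c b ac cb IH].
  by left; apply: sim_refl.
case: ac => [ac|ac]; last first.
  by right; exists c => //; apply: clos_rt1n_rt.
case: IH => [cb'|[d cd db]]; first by left; apply: sim_trans ac cb'.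
by right; exists d => //; apply: elem_step_sim cd; rewrite ?sim_refl // sim_sym.
Qed.

(** A discrete intermediate value principle: [P] is invariant under [sim], so along a chain it can
    only change at a genuine step. *)
Lemma elem_le_switch (P : pred A) a b :
  (forall x y, sim x y -> P x -> P y) -> elem_le a b -> ~~ P a -> P b ->
  exists x y, [/\ elem_step x y, elem_le a x, ~~ P x & P y].
Proof.
move=> Psim ab; elim: (clos_rt_rt1n _ _ _ _ ab) => {a b ab} [a /negPf-> //|a c b ac _ IH nPa Pb].
have [Pc|nPc] := boolP (P c).
  case: ac => [ac|ac]; last by exists a, c; split=> //; apply: elem_le_refl.
  by case/negP: nPa; apply: Psim Pc; rewrite sim_sym.
have [x [y [xy cx nPx Py]]] := IH nPc Pb.
exists x, y; split=> //; apply: elem_le_trans cx.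
by case: ac => [/elem_le_sim | /elem_le_step].
Qed.

(** * Retractions onto a step *)

Section Retraction.
Variables (s t : A) (e : A -> A).
Hypotheses (st : elem_step s t) (pe : unary_polynomial w e).
Hypothesis e_cases : forall x, sim (e x) s || sim (e x) t.

(** A step sent from the class of t to the class of s would make (t, s) a step, against
    asymmetry. *)
Lemma retraction_up x y : elem_le x y -> sim (e x) t -> sim (e y) t.
Proof.
elim=> {x y} [x y [xy|xy]|//|x y z _ xy _ yz /xy /yz //] ext.
  by apply: sim_trans ext; apply: sim_unary => //; rewrite sim_sym.
case/orP: (e_cases y) => // eys; have [nst _ _ _] := st.
case: (elem_step_asym st); apply: (elem_step_sim ext eys).
apply: elem_step_unary => //; apply: contra nst => exy.
by rewrite sim_sym; apply: sim_trans eys; apply: sim_trans exy; rewrite sim_sym.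
Qed.

Lemma retraction_low x : ~~ sim (e x) t -> sim (e x) s.
Proof. by case/orP: (e_cases x) => // ->. Qed.

(* If the conclusion failed, moving along the chains from a to b and from a'  *)
(* to b' would reach steps x, x' and y, y' on which e \o h is a join; pulling *)
(* it back along polynomial inverses contradicts the choice of (s, t).        *)
Lemma retraction_meet h a b a' b' :
  binary_polynomial w h -> elem_le a b -> elem_le a' b' ->
  sim (e (h b a')) t -> sim (e (h a b')) t -> sim (e (h a a')) t.
Proof.
move=> ph ab ab' hba' hab'; apply: contraT => nhaa'.
have [nst _ _ nojoin] := st.
have pl z : unary_polynomial w (fun x => e (h x z)).
  exact: polynomial_comp1 pe (binary_polynomial_l z ph).
have pr z : unary_polynomial w (fun x => e (h z x)).
  exact: polynomial_comp1 pe (binary_polynomial_r z ph).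
have t_sim p : unary_polynomial w p ->
    forall x y, sim x y -> sim (p x) t -> sim (p y) t.
  by move=> pp x y xy; apply: sim_trans; apply: sim_unary => //; rewrite sim_sym.
have [x [x' [xx' ax nTx Tx']]] :=
  elem_le_switch (P := fun x => sim (e (h x a')) t) (t_sim _ (pl a')) ab nhaa' hba'.
have hxb' : sim (e (h x b')) t.
  apply: retraction_up hab'; exact: (elem_le_unary (binary_polynomial_l b' ph)).
have [y [y' [yy' a'y nTy Ty']]] :=
  elem_le_switch (P := fun y => sim (e (h x y)) t) (t_sim _ (pr x)) ab' nTx hxb'.
have Txy : sim (e (h x' y)) t.
  apply: retraction_up Tx'; exact: (elem_le_unary (binary_polynomial_r x' ph)).
have hxy := retraction_low nTy.
have nhs z : sim z t -> ~~ sim (e (h x y)) z.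
  by move=> zt; apply: contra nTy => /sim_trans; apply.
have [q1 pq1 [_ q1x q1x']] := elem_step_left_inverse xx' (pl y) (nhs _ Txy).
have [q2 pq2 [_ q2y q2y']] := elem_step_left_inverse yy' (pr x) (nhs _ Ty').
have pj : binary_polynomial w (fun c d => e (h (q1 c) (q2 d))).
  exact: (binary_polynomial_comp pe pq1 pq2 ph).
have q1s : sim (q1 s) x.
  by apply: sim_trans q1x; apply: sim_unary => //; rewrite sim_sym.
have q1t : sim (q1 t) x'.
  by apply: sim_trans q1x'; apply: sim_unary => //; rewrite sim_sym.
have q2s : sim (q2 s) y.
  by apply: sim_trans q2y; apply: sim_unary => //; rewrite sim_sym.
have q2t : sim (q2 t) y'.
  by apply: sim_trans q2y'; apply: sim_unary => //; rewrite sim_sym.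
have eh c d c' d' : sim c c' -> sim d d' -> sim (e (h c d)) (e (h c' d')).
  by move=> cc' dd'; apply: sim_unary => //; apply: sim_binary.
have := nojoin _ pj (sim_trans (eh _ _ _ _ q1s q2t) Ty')
  (sim_trans (eh _ _ _ _ q1t q2s) Txy).
by rewrite (sim_trans (eh _ _ _ _ q1s q2s) hxy).
Qed.

End Retraction.

Lemma elem_step_retraction s t : elem_step s t ->
  exists2 e, unary_polynomial w e &
    [/\ forall x, sim (e x) s || sim (e x) t, sim (e s) s & sim (e t) t].
Proof.
move=> st; have [nst _ _ _] := st.
exact: elem_step_left_inverse st (unary_polynomial_id w) nst.
Qed.

(** The first step (a, t) of a chain from a to b has a retraction, and [retraction_up] carries the
    value t up to b; so strict inequalities are detected by a retraction at the lower end. *)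
Lemma elem_lt_retraction a b : elem_le a b -> ~~ sim a b ->
  exists t e, [/\ elem_step a t, unary_polynomial w e,
    forall x, sim (e x) a || sim (e x) t,
    ~~ sim (e a) t & sim (e b) t].
Proof.
move=> /elem_le_first_step[-> //|[t at_ tb]] _.
have [e pe [e_cases ea et]] := elem_step_retraction at_.
exists t, e; split=> //; last exact: (retraction_up at_) tb et.
case: at_ => nat _ _ _; apply: contra nat => eat.
by apply: sim_trans eat; rewrite sim_sym.
Qed.

Lemma elem_le_antisym a b : elem_le a b -> elem_le b a -> sim a b.
Proof.
move=> ab ba; apply: contraT => nab.
have [t [e [at_ pe e_cases nea eb]]] := elem_lt_retraction ab nab.
by rewrite (retraction_up at_ pe e_cases ba eb) in nea.
Qed.

(** * Wnu polynomials on comparable elements *)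

Section WeakNearUnanimity.
Variable f : operation A n.
Hypotheses (pf : polynomial w f) (f_wnu : weak_near_unanimity f).

Let f_id : forall x, f [tuple x | _ < n] = x. Proof. by case: f_wnu. Qed.

Lemma polynomial_blocks (c : 'I_n -> A) (P Q : pred 'I_n) :
  binary_polynomial w
    (fun x y => f [tuple if P i then x else if Q i then y else c i | i < n]).
Proof.
apply: (polynomial_comp (g := fun i (z : 2.-tuple A) => if P i then tnth z ord0
    else if Q i then tnth z ord_max else c i)) => // i.
case: (P i); first exact: polynomial_var.
by case: (Q i); [apply: polynomial_var | apply: polynomial_const].
Qed.

(** Otherwise the value c is strictly above a, and some retraction e separates them. Let h(x, y) =
    f(x, y, a, ..., a), which takes two distinct positions. By the wnu identities h(b, a) = h(a, b)
    = c, so [retraction_meet] forces e(h(a, a)) = e(a) to the top class, a contradiction. *)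
Lemma wnu_low (i : 'I_n) a b :
  1 < n -> elem_le a b -> sim (f (one_at n i a b)) a.
Proof.
move=> n_gt1 ab.
pose i0 : 'I_n := Ordinal (ltnW n_gt1); pose i1 : 'I_n := Ordinal n_gt1.
rewrite sim_sym; apply: contraT => nac.
have ac : elem_le a (f (one_at n i a b)).
  rewrite -{1}[a]f_id; apply: elem_le_polynomial => // k; rewrite !tnth_mktuple.
  by case: ifP => // _; apply: elem_le_refl.
have [t [e [at_ pe e_cases nea ec]]] := elem_lt_retraction ac nac.
case/negP: nea; case: f_wnu => _ f_sym.
pose h x y := f [tuple if k == i0 then x else if k == i1 then y else a | k < n].
have <- : h a a = a.
  rewrite -[RHS]f_id; congr f; apply: eq_from_tnth => k.
  by rewrite !tnth_mktuple !if_same.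
apply: (retraction_meet at_ pe e_cases _ ab ab).
- exact: (polynomial_blocks (fun=> a) (pred1 i0) (pred1 i1)).
- suff -> : h b a = f (one_at n i a b) by [].
  rewrite (f_sym i i0); congr f; apply: eq_from_tnth => k.
  by rewrite !tnth_mktuple if_same.
- suff -> : h a b = f (one_at n i a b) by [].
  rewrite (f_sym i i1); congr f; apply: eq_from_tnth => k.
  rewrite !tnth_mktuple -[k == i1 :> nat]/(k == i1).
  by case: eqP => // ->.
Qed.

(** If a single a among b's left the value at b, then e f would stay at the top as a fills the
    positions from the left: [retraction_meet] combines the tuple with a in the first k positions
    and the one with a only in position k. At k = n this says that e(a) is at the top, which it is
    not. *)
Lemma wnu_high (i : 'I_n) a b :
  elem_le a b -> ~~ sim a b -> ~~ sim (f (one_at n i b a)) b.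
Proof.
move=> ab nab.
have [t [e [at_ pe e_cases nea eb]]] := elem_lt_retraction ab nab.
apply: contra nea => fb.
have f_one j : j < n -> sim (e (f (one_at n j b a))) t.
  move=> lt_j; case: f_wnu => _ /(_ (Ordinal lt_j) i) /= ->.
  by apply: sim_trans eb; apply: sim_unary.
pose z k := [tuple if i < k then a else b | i < n].
suff zt k : k <= n -> sim (e (f (z k))) t.
  have := zt n (leqnn n); congr (sim (e _) t); rewrite -[RHS]f_id; congr f.
  by apply: eq_from_tnth => j; rewrite !tnth_mktuple ltn_ord.
elim: k => [_|k IHk lt_kn].
  suff -> : f (z 0) = b by [].
  by rewrite -[RHS]f_id; congr f; apply: eq_from_tnth => j; rewrite !tnth_mktuple.
pose h x y := f [tuple if j < k then x else if j == k :> nat then y else b | j < n].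
have -> : f (z k.+1) = h a a.
  congr f; apply: eq_from_tnth => j; rewrite !tnth_mktuple ltnS.
  by case: ltngtP.
apply: (retraction_meet at_ pe e_cases _ ab ab).
- exact: (polynomial_blocks (fun=> b) (fun j => j < k) (fun j => j == k :> nat)).
- have := f_one k lt_kn; congr (sim (e (f _)) t); apply: eq_from_tnth => j; rewrite !tnth_mktuple.
  by case: ltngtP.
- have := IHk (ltnW lt_kn); congr (sim (e (f _)) t).
  by apply: eq_from_tnth => j; rewrite !tnth_mktuple if_same.
Qed.

Lemma one_at_le i a b : elem_le a b ->
  elem_le a (f (one_at n i b a)) /\ elem_le (f (one_at n i b a)) b.
Proof.
move=> ab; rewrite -{1}[a]f_id -{3}[b]f_id.
by split; apply: elem_le_polynomial => // k; rewrite !tnth_mktuple;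
  case: ifP => // _; apply: elem_le_refl.
Qed.

Lemma sim_one_at i a b a' b' : sim a a' -> sim b b' ->
  sim (f (one_at n i a b)) (f (one_at n i a' b')).
Proof.
by move=> aa' bb'; apply: sim_polynomial => // k; rewrite !tnth_mktuple; case: ifP.
Qed.

(* With c = f(a, b, ..., b) one has c o b ~ c by wnu_low, so the next value   *)
(* is f(c o a, c, ..., c), and c o a < c unless c ~ a.                        *)
Lemma wnu_step_descent (a b : A) : 1 < n -> elem_le a b ->
  let c := f (one_at n 0 b a) in let d := wnu_step f (one_at n 0 b a) in
  [/\ elem_le d c, sim c a -> sim d a & ~~ sim c a -> ~~ sim d c].
Proof.
move=> n_gt1 ab c d.
pose i0 : 'I_n := Ordinal (ltnW n_gt1).
have [ac cb] := one_at_le 0 ab; rewrite -/c in ac cb.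
have [aca cac] := one_at_le 0 ac.
have dE : sim d (f (one_at n 0 c (circ f c a))).
  rewrite /d wnu_step_one_at; apply: sim_one_at; last exact: sim_refl.
  exact: (wnu_low i0).
have [_ dc] := one_at_le 0 cac.
split=> [|ca|nca].
- exact: elem_le_trans (elem_le_sim dE) dc.
- apply: sim_trans dE _.
  have circa : sim (circ f c a) a.
    have /= := sim_one_at 0 ca (sim_refl a).
    rewrite (_ : one_at n 0 a a = [tuple a | _ < n]) ?f_id //.
    by apply: eq_from_tnth => k; rewrite !tnth_mktuple if_same.
  have /= := sim_one_at 0 ca circa.
  rewrite (_ : one_at n 0 a a = [tuple a | _ < n]) ?f_id //.
  by apply: eq_from_tnth => k; rewrite !tnth_mktuple if_same.
- have ncac : ~~ sim (circ f c a) c by apply: (wnu_high i0) => //; rewrite sim_sym.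
  apply: contra (wnu_high i0 cac ncac) => dc'.
  by apply: sim_trans dc'; rewrite sim_sym.
Qed.

End WeakNearUnanimity.

(** * The descending sequence w_i(a, b, ..., b) *)

Lemma wnu_iter k : weak_near_unanimity w ->
  polynomial w (iter k (@wnu_step A n) w) /\
  weak_near_unanimity (iter k (@wnu_step A n) w).
Proof.
move=> w_wnu; elim: k => [|k [pk wk]] /=; first by split=> //; apply: polynomial_basic.
by split; [apply: polynomial_wnu_step | apply: wnu_step_wnu].
Qed.

(* Idempotency forces a unary or nullary operation to be trivial, which       *)
(* leaves only projections and constants as polynomials: no meet.             *)
Lemma elem_step_arity a b :
  (forall x, w [tuple x | _ < n] = x) -> elem_step a b -> 1 < n.
Proof.
move=> w_id [nab _ [m [t mt] [m1 m2 m3]] _]; rewrite ltnNge; apply/negP => le_n1.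
have ord_val (k : 'I_n) : k = 0 :> nat.
  by apply/eqP; rewrite -leqn0 -ltnS (leq_trans (ltn_ord k)).
have eq_w x i : w x = tnth x i.
  rewrite -[RHS]w_id; congr w; apply: eq_from_tnth => j; rewrite tnth_mktuple.
  by congr tnth; apply: val_inj; rewrite /= !ord_val.
have [n0|n_gt0] := posnP n.
  case/negP: nab; rewrite -[a]w_id -[b]w_id.
  rewrite (_ : [tuple a | _ < n] = [tuple b | _ < n]) ?sim_refl //.
  by apply: eq_from_tnth => i; have := ltn_ord i; rewrite {2}n0.
have t_trivial : (exists i, forall x, peval w t x = tnth x i) \/
    (exists c, forall x, peval w t x = c).
  elim: (t) => [i|c|args IH]; [by left; exists i | by right; exists c |].
  have eval x : peval w (POp args) x = peval w (args (Ordinal n_gt0)) x.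
    by rewrite /= (eq_w _ (Ordinal n_gt0)) tnth_mktuple.
  by case: (IH (Ordinal n_gt0)) => [] [c cP]; [left | right]; exists c => x;
    rewrite eval.
have mE x y : m x y = peval w t [tuple x; y] by rewrite -mt.
case: t_trivial => -[c cP]; move: m1 m2 m3; rewrite !mE !cP.
  by case: c {cP} => [[|[|//]] lt_c] /= m1 m2 _; case/negP: nab; rewrite sim_sym.
by move=> ca _ cb; case/negP: nab; apply: sim_trans cb; rewrite sim_sym.
Qed.

(** Once in the class of a the sequence stays there, and before that it descends strictly. If it
    never arrived, antisymmetry would make its terms distinct, too many for A. *)
Lemma wnu_seq_low a b : weak_near_unanimity w -> elem_le a b -> ~~ sim a b ->
  sim (wnu_seq w #|A| (one_at n 0 b a)) a.
Proof.
move=> w_wnu ab nab.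
have [w_id _] := w_wnu.
have n_gt1 : 1 < n.
  by have [t [e [/(elem_step_arity w_id)]]] := elem_lt_retraction ab nab.
(* The term with index k is w_k(a, b, ..., b), and b is put in front at index 0; the indices 0 to
   |A| then give |A| + 1 terms for the pigeonhole count. *)
pose c k := if k is k'.+1 then iter k' (@wnu_step A n) w (one_at n 0 b a) else b.
have c_step k : [/\ elem_le (c k.+1) (c k), sim (c k) a -> sim (c k.+1) a &
    ~~ sim (c k) a -> ~~ sim (c k.+1) (c k)].
  case: k => [|k]; last first.
    by have [pk wk] := wnu_iter k w_wnu; apply: wnu_step_descent.
  have [pw _] := wnu_iter 0 w_wnu.
  split=> [||_] /=; first by have [_] := one_at_le pw w_wnu 0 ab.
    by rewrite sim_sym (negPf nab).
  exact: (wnu_high pw w_wnu (Ordinal (ltnW n_gt1))).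
have card_gt0 : 0 < #|A| by apply/card_gt0P; exists a.
rewrite /wnu_seq -[iter _ _ _ _]/(c #|A|.-1.+1) prednK //.
apply: contraT => nca.
have nc k : k <= #|A| -> ~~ sim (c k) a.
  move=> le_k; apply: contra nca => ck; rewrite -(subnKC le_k).
  elim: (_ - k) => [|j IHj]; first by rewrite addn0.
  by rewrite addnS; have [_ + _] := c_step (k + j); apply.
have c_le i j : elem_le (c (i + j)) (c i).
  elim: j => [|j IHj]; first by rewrite addn0; apply: elem_le_refl.
  by rewrite addnS; have [+ _ _] := c_step (i + j) => /elem_le_trans; apply.
have c_neq i j : i < j -> j <= #|A| -> c i <> c j.
  move=> lt_ij le_j cij; have [ci _] := c_step i.
  move/(_ (nc i (leq_trans (ltnW lt_ij) le_j))) => /negP; apply.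
  apply: elem_le_antisym => //; rewrite cij -(subnKC lt_ij); exact: c_le.
have c_inj : injective (fun i : 'I_#|A|.+1 => c i).
  move=> i j cij; apply: val_inj => /=.
  by case: (ltngtP i j) => // lt_ij; [case: (c_neq i j) | case: (c_neq j i)];
    rewrite // -ltnS.
by have := leq_card _ c_inj; rewrite card_ord ltnn.
Qed.

(** * From the order on classes to the preorder on elements *)

Lemma classesP C :
  C \in classes sim -> exists2 a, a \in C & forall x, (x \in C) = sim a x.
Proof.
case/imsetP => a _ ->; exists a => [|x]; rewrite !inE //; exact: sim_refl.
Qed.

(** The chart lifts the boolean meet to a polynomial of the algebra. Conversely, a join polynomial,
    retracted into U, would induce on the two-element chain a semilattice polynomial that does not
    preserve meets. *)
Lemma basic_below_elem_step C1 C2 a b : basic_below w sim C1 C2 ->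
  a \in C1 -> b \in C2 -> elem_step a b.
Proof.
case=> /classesP[a0 _ C1E] /classesP[b0 _ C2E] [U [phi [minU [phiE phiT chart] U1 U2]]] aC bC.
have Ub (c : bool) : exists2 u, u \in U & phi u = c.
  have /imsetP[u uU ->] : c \in phi @: U by rewrite phiT inE.
  by exists u.
have [u uU phiu] := Ub false; have [v vU phiv] := Ub true.
have sim_class C c0 c x : (forall x, (x \in C) = sim c0 x) -> c \in C -> x \in C -> sim c x.
  by move=> CE; rewrite !CE => c0c; apply: sim_trans; rewrite sim_sym.
have C1U x : x \in U -> ~~ phi x -> x \in C1.
  move=> xU phix; have : x \in [set x in U | ~~ phi x] by rewrite inE xU.
  by rewrite -U1 inE => /andP[].
have C2U x : x \in U -> phi x -> x \in C2.
  move=> xU phix; have : x \in [set x in U | phi x] by rewrite inE xU.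
  by rewrite -U2 inE => /andP[].
have au : sim a u by apply: sim_class C1E aC _; apply: C1U; rewrite ?phiu.
have bv : sim b v by apply: sim_class C2E bC _; apply: C2U; rewrite ?phiv.
have nuv : ~~ sim u v by rewrite phiE // phiu phiv.
apply: (@elem_step_sim u v); rewrite 1?sim_sym //.
split=> //.
- exists U, u, v; split=> //; first by split; apply: sim_refl.
  by move=> x xU; rewrite !phiE // phiu phiv; case: (phi x).
- have [/(_ (polynomial_basic _)) [f [pf fU fE]] _] := chart 2 bool_meet.
  have ft x y : x \in U -> y \in U -> f [tuple x; y] \in U /\
      phi (f [tuple x; y]) = phi x && phi y.
    move=> xU yU; have xyU i : tnth [tuple x; y] i \in U.
      by case: i => [[|[|//]] lt_i].
    by split; [apply: fU | rewrite fE // /bool_meet !tnth_map].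
  exists (fun x y => f [tuple x; y]); first exact: binary_polynomial_of.
  have [fuvU phi_uv] := ft u v uU vU; have [fvuU phi_vu] := ft v u vU uU.
  have [fvvU phi_vv] := ft v v vU vU.
  by rewrite !phiE // phi_uv phi_vu phi_vv phiu phiv.
move=> h ph huv hvu; apply/negP => huu.
have nidid : ~~ sim (id u) (id v) by [].
have [e pe [eU eK]] := minimal_set_left_inverse minU (unary_polynomial_id w) uU vU nidid.
pose f (x : 2.-tuple A) := e (h (tnth x ord0) (tnth x ord_max)).
have pf : polynomial w f := polynomial_comp1 pe ph.
have f_phi x y z : x \in U -> y \in U -> z \in U -> sim (h x y) z -> phi (f [tuple x; y]) = phi z.
  move=> xU yU zU hxy; apply/eqP; rewrite -phiE //; last exact: eU.
  by rewrite -[z in sim _ z](eK z zU); apply: sim_unary.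
pose r (c : bool) := if c then v else u.
have rU c : r c \in U by case: c.
have phir c : phi (r c) = c by case: c.
pose g (x : 2.-tuple bool) := phi (f (map_tuple r x)).
have pg : polynomial bool_meet g.
  apply/chart; exists f; split=> // [x _|x xU]; first exact: eU.
  apply/eqP; rewrite -phiE; try exact: eU.
  apply: sim_polynomial => // i; rewrite !tnth_map.
  by rewrite phiE // phir.
(* Preservation of the meet of (0, 1) and (1, 0) would give g(0, 0) = g(0, 1) && g(1, 0), that is
   false = true. *)
have := bool_polynomial_meet [tuple false; true] [tuple true; false] pg.
have gE (c d : bool) : g [tuple c; d] = phi (f [tuple r c; r d]).
  by congr (phi (f _)); apply: eq_from_tnth => -[[|[|//]] lt_i].
rewrite (_ : [tuple _ | _ < _] = [tuple false; false]).
  by rewrite !gE /= (f_phi u v v) // (f_phi v u v) // (f_phi u u u) // phiu phiv.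
by apply: eq_from_tnth => -[[|[|//]] lt_i]; rewrite tnth_mktuple.
Qed.

Lemma class_le_elem_le C1 C2 a b : C1 \in classes sim -> class_le w sim C1 C2 ->
  a \in C1 -> b \in C2 -> elem_le a b.
Proof.
move=> C1c C12; elim: (clos_rt_rt1n _ _ _ _ C12) a C1c => {C1 C2 C12}.
  move=> C a /classesP[a0 _ CE]; rewrite !CE => a0a a0b; apply: elem_le_sim.
  by apply: sim_trans a0b; rewrite sim_sym.
move=> C1 C C2 C1C _ IH a _ aC1 bC2; have [_ Cc _] := C1C.
have [c cC _] := classesP Cc.
apply: (@elem_le_trans c); last exact: IH.
exact: elem_le_step (basic_below_elem_step C1C aC1 cC).
Qed.

End MinimalSets.

(** * The meet on the two classes and the conclusion *)

Lemma big_chain_meet (A : finType) (O I : {set A}) n (X : n.-tuple {set A}) :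
  \big[chain_meet O I/I]_(i < n) tnth X i
    = if [exists i, tnth X i == O] then O else I.
Proof.
have -> : [exists i, tnth X i == O] = has (fun i => tnth X i == O) (index_enum 'I_n).
  apply/existsP/hasP => [[i Xi]|[i _ Xi]]; exists i => //.
  exact: mem_index_enum.
elim: (index_enum 'I_n) => [|i s IHs] /=; first by rewrite big_nil.
rewrite big_cons IHs /chain_meet; case: eqP => //= _.
by case: (has _ s); rewrite ?eqxx //; case: eqP.
Qed.

Theorem theorem3p3 (A : finType) (n : nat) (w : operation A n) (sim : rel A)
    (w_wnu : weak_near_unanimity w)
    (sim_abelian : abelian_congruence w sim)
    (sim_cover : covered_by w sim full_rel)
    (sim_type5 : has_type5 w sim full_rel)
    (O I : {set A}) (O_class : O \in classes sim) (I_class : I \in classes sim)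
    (ltOI : class_lt w sim O I) :
  subuniverse (wnu_seq w #|A|) (O :|: I) /\
  forall X : n.-tuple {set A},
    (forall i, tnth X i \in [set O; I]) ->
    quotient_op sim (wnu_seq w #|A|) X
      = \big[chain_meet O I/I]_(i < n) tnth X i.
Proof.
have [o oO OE] := classesP sim_cover O_class.
have [i iI IE] := classesP sim_cover I_class.
case: ltOI => leOI neqOI.
have oi : elem_le w sim o i := class_le_elem_le sim_cover O_class leOI oO iI.
have noi : ~~ sim o i.
  apply/negP => oi'; case: neqOI; apply/setP => x; rewrite OE IE.
  apply/idP/idP; last exact: (sim_trans sim_cover oi').
  by apply: (sim_trans sim_cover); rewrite (sim_sym sim_cover).
set f := wnu_seq w #|A|.
have [pf [f_id f_sym]] : polynomial w f /\ weak_near_unanimity f.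
  exact: wnu_iter.
have le_o x : x \in O :|: I -> elem_le w sim o x.
  rewrite inE OE IE => /orP[ox|ix]; first exact: elem_le_sim.
  exact: elem_le_trans oi (elem_le_sim w ix).
have le_i x : x \in O :|: I -> elem_le w sim x i.
  rewrite inE OE IE => /orP[ox|ix].
    by apply: elem_le_trans oi; apply: elem_le_sim; rewrite (sim_sym sim_cover).
  by apply: elem_le_sim; rewrite (sim_sym sim_cover).
(* With coordinate k in O, f x is above f(o, ..., o) = o and below f at the tuple with o in position
   k and i elsewhere, which is in O by [wnu_seq_low] and the wnu identities. With no coordinate in
   O, all are in the class of i. *)
have f_meet (x : n.-tuple A) : (forall k, tnth x k \in O :|: I) ->
    f x \in if [exists k, tnth x k \in O] then O else I.
  move=> xOI; case: existsP => [[k xk]|nxO].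
    rewrite OE; apply: (elem_le_antisym sim_cover).
      rewrite -[o]f_id; apply: (elem_le_polynomial sim_cover) => // j.
      by rewrite tnth_mktuple; apply: le_o.
    have n_gt0 : 0 < n := leq_ltn_trans (leq0n k) (ltn_ord k).
    apply: (@elem_le_trans _ _ _ _ (f (one_at n 0 i o))); last first.
      exact/elem_le_sim/wnu_seq_low.
    rewrite -[0]/(val (Ordinal n_gt0)) (f_sym _ k).
    apply: (elem_le_polynomial sim_cover) => // j; rewrite tnth_mktuple.
    case: eqP => [/val_inj->|_]; last exact: le_i.
    by apply: elem_le_sim; rewrite (sim_sym sim_cover) -OE.
  rewrite IE -{1}[i]f_id; apply: (sim_polynomial sim_cover) => // k.
  rewrite tnth_mktuple -IE; have := xOI k; rewrite inE => /orP[xk|//].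
  by case: nxO; exists k.
split=> [x /f_meet|X XOI]; first by rewrite inE; case: ifP => _ ->; rewrite ?orbT.
rewrite big_chain_meet.
have X_meet (x : n.-tuple A) : (forall k, tnth x k \in tnth X k) ->
    f x \in if [exists k, tnth X k == O] then O else I.
  move=> xX.
  (* Distinct classes are disjoint, so an entry lies in O exactly when its class is O. *)
  rewrite (_ : [exists k, _] = [exists k, tnth x k \in O]); first apply: f_meet.
    by move=> k; have := xX k; rewrite inE; case/set2P: (XOI k) => -> ->; rewrite ?orbT.
  apply: eq_existsb => k; have := xX k; case/set2P: (XOI k) => ->.
    by rewrite eqxx => ->.
  rewrite IE OE => ix; have /eqP := neqOI; rewrite eq_sym => /negPf->.
  apply/esym; apply: contraNF noi => ox; apply: (sim_trans sim_cover ox).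
  by rewrite (sim_sym sim_cover).
have class_sim x y D : D \in classes sim -> x \in D -> (y \in D) = sim x y.
  case/(classesP sim_cover) => d _ DE; rewrite !DE => dx.
  apply/idP/idP; last exact: (sim_trans sim_cover dx).
  by apply: (sim_trans sim_cover); rewrite (sim_sym sim_cover).
have D_class : (if [exists k, tnth X k == O] then O else I) \in classes sim.
  by case: ifP.
apply/setP => y; rewrite inE; apply/existsP/idP.
  move=> [x /andP[/forallP xX fxy]].
  by rewrite (class_sim (f x)) // X_meet.
(* The representatives o and i witness that every y in the target class is in the quotient value. *)
move=> yD; pose x := [tuple if tnth X k == O then o else i | k < n].
have xX k : tnth x k \in tnth X k.
  rewrite tnth_mktuple; case: eqP => [->//|nXO].
  by case/set2P: (XOI k) => [/nXO//|->].
exists x; apply/andP; split; first exact/forallP.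
by rewrite -(class_sim _ _ _ D_class) // X_meet.
Qed.
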